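(* Let $f$ be any honest function. Then $f\leq_{PR}\hat{G}^{\alpha^f}$, i.e. $f$ is primitive recursive in $\hat{G}^{\alpha^f}$.
   Context: A function is elementary if it can be generated from $2^x$, $\max$, $0$, successor and projections by composition and bounded primitive recursion; a relation is elementary if its characteristic function is. $\phi\leq_{PR}\psi$ means $\phi$ can be generated from the initial functions $\psi$, $2^x$, $\max$, $0$, successor, projections by composition and (unbounded) primitive recursion. Rationals are coded into $\mathbb{N}$ in a standard elementary way. A function $f:\mathbb{N}\to\mathbb{N}$ is honest if $f(x)\le f(x+1)$, $f(x)\geq 2^x$ for all $x$, and the relation $f(x)=y$ is elementary. Let $P_i$ denote the $i$-th prime ($P_0=2$). Define $g(0)=1$, $g(j+1)=P_j^{2(j+2)(g(j)+1)^3}$, $h(i)=g(f(i)+i)$, $\alpha^f_n=\sum_{i=0}^nP_i^{-h(i)}$, $\alpha^f=\lim_n\alpha^f_n$ (an irrational in $(0,1)$). For irrational $\alpha\in(0,1)$ and base $b\ge 2$ write uniquely $\alpha=\sum_{i\ge1}\mathtt{D}_ib^{-k_i}$ with $\mathtt{D}_i\in\{1,\dots,b-1\}$, $0<k_1<k_2<\cdots$; the general sum approximation from below is $\hat{G}^\alpha:\mathbb{N}\times\mathbb{N}\to\mathbb{Q}$ with $\hat{G}^\alpha(b,0)=0$, $\hat{G}^\alpha(b,n)=\mathtt{D}_nb^{-k_n}$ for $n>0$ and $b\ge 2$, and $\hat{G}^\alpha(b,n)=0$ for $b<2$. *)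

(* Defs.v *)
From mathcomp Require Import all_boot all_order all_algebra.
From mathcomp Require Import all_classical all_reals all_analysis.

Set Implicit Arguments.
Unset Strict Implicit.
Unset Printing Implicit Defensive.

Import Order.TTheory GRing.Theory Num.Theory.
Import numFieldNormedType.Exports.

Local Open Scope nat_scope.
Local Open Scope classical_set_scope.

Definition natfun (n : nat) := n.-tuple nat -> nat.

Definition natfun1 (f : nat -> nat) : natfun 1 := fun v => f (nth 0 v 0).

Definition natfun2 (f : nat -> nat -> nat) : natfun 2 :=
  fun v => f (nth 0 v 0) (nth 0 v 1).

(* The constant 0 is taken of arity 0; composition with [m = 0] below gives the
   zero functions of all arities. *)
Inductive initial : forall n, natfun n -> Prop :=
| initial_exp2 : initial (natfun1 (fun x => 2 ^ x))
| initial_max : initial (natfun2 maxn)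
| initial_zero : initial ((fun=> 0) : natfun 0)
| initial_succ : initial (natfun1 succn)
| initial_proj n (i : 'I_n) : initial ((fun v => tnth v i) : natfun n).

Definition is_comp m n (f : natfun n) (h : natfun m) (g : 'I_m -> natfun n) :=
  forall v, f v = h [tuple g i v | i < m].

(* The recursion variable is the first argument. *)
Definition is_primrec n (f : natfun n.+1) (g : natfun n) (h : natfun n.+2) :=
  (forall v : n.-tuple nat, f [tuple of 0 :: v] = g v) /\
  (forall y (v : n.-tuple nat), f [tuple of y.+1 :: v] =
               h [tuple of [:: y, f [tuple of y :: v] & v]]).

Inductive elementary : forall n, natfun n -> Prop :=
| elem_initial n (f : natfun n) : initial f -> elementary f
| elem_comp m n (f : natfun n) (h : natfun m) (g : 'I_m -> natfun n) :
    elementary h -> (forall i, elementary (g i)) -> is_comp f h g ->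
    elementary f
| elem_bprimrec n (f : natfun n.+1) (g : natfun n) (h : natfun n.+2)
    (j : natfun n.+1) :
    elementary g -> elementary h -> elementary j ->
    is_primrec f g h -> (forall v, f v <= j v) ->
    elementary f.

(* [primrec_in psi phi] : phi is primitive recursive in psi, phi <=_PR psi. *)
Inductive primrec_in p (psi : natfun p) : forall n, natfun n -> Prop :=
| prin_oracle : primrec_in psi psi
| prin_initial n (f : natfun n) : initial f -> primrec_in psi f
| prin_comp m n (f : natfun n) (h : natfun m) (g : 'I_m -> natfun n) :
    primrec_in psi h -> (forall i, primrec_in psi (g i)) -> is_comp f h g ->
    primrec_in psi f
| prin_primrec n (f : natfun n.+1) (g : natfun n) (h : natfun n.+2) :
    primrec_in psi g -> primrec_in psi h -> is_primrec f g h ->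
    primrec_in psi f.

Definition elementary_rel2 (r : rel nat) :=
  elementary (natfun2 (fun x y => nat_of_bool (r x y))).

Definition honest (f : nat -> nat) :=
  [/\ forall x, f x <= f x.+1,
      forall x, 2 ^ x <= f x &
      elementary_rel2 (fun x y => f x == y)].

(* Rationals are coded as the Cantor pair of (the code of) the numerator and
   the positive denominator in lowest terms. *)
Definition pair_code (a b : nat) : nat := ((a + b) * (a + b).+1)./2 + a.

Definition int_code (z : int) : nat :=
  match z with Posz n => n.*2 | Negz n => n.*2.+1 end.

Definition rat_code (q : rat) : nat :=
  pair_code (int_code (numq q)) (absz (denq q)).

Lemma ex_prime_above (m : nat) : exists p, (m < p) && prime p.
Proof. by have [p mp pp] := prime_above m; exists p; rewrite mp pp. Qed.

Fixpoint nth_prime (i : nat) : nat :=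
  match i with
  | 0 => 2
  | i'.+1 => ex_minn (ex_prime_above (nth_prime i'))
  end.

Fixpoint gseq (j : nat) : nat :=
  match j with
  | 0 => 1
  | j'.+1 => nth_prime j' ^ (2 * (j' + 2) * (gseq j' + 1) ^ 3)
  end.

Definition hseq (f : nat -> nat) (i : nat) : nat := gseq (f i + i).

Arguments nth_prime : simpl never.
Arguments gseq : simpl never.

Definition alpha_seq (R : realType) (f : nat -> nat) (n : nat) : R :=
  (\sum_(i < n.+1) (nth_prime i)%:R ^- hseq f i)%R.

Definition alpha (R : realType) (f : nat -> nat) : R :=
  limn (alpha_seq R f).

(* Indices are shifted by one: [Dk.1 i] and [Dk.2 i] are D_{i+1} and k_{i+1}. *)
Definition is_expansion (R : realType) (a : R) (b : nat)
    (Dk : (nat -> nat) * (nat -> nat)) : Prop :=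
  [/\ forall i, 0 < Dk.1 i < b,
      0 < Dk.2 0,
      forall i, Dk.2 i < Dk.2 i.+1 &
      (series (fun i => (Dk.1 i)%:R * b%:R ^- Dk.2 i) @ \oo --> a)%R].

(* For b >= 2 and a in (0,1), there is exactly one such expansion; the default
   value of [xget] is then irrelevant. *)
Definition expansion (R : realType) (a : R) (b : nat)
    : (nat -> nat) * (nat -> nat) :=
  xget (fun=> 0, fun=> 0) [set Dk | is_expansion a b Dk].

Definition ghat (R : realType) (a : R) (b n : nat) : rat :=
  match n with
  | 0 => 0%R
  | n'.+1 => if b < 2 then 0%R
             else (((expansion a b).1 n')%:R * b%:R ^- (expansion a b).2 n')%R
  end.

Definition ghat_coded (R : realType) (a : R) : natfun 2 :=
  natfun2 (fun b n => rat_code (ghat a b n)).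

(* Main.v *)
(* Let [b] be a common multiple of the primes [P_0, ..., P_n]. In base [b] the
   partial sum [alpha_n] has at most [h n] digits, and since [h (n+1)] is far
   larger than [b ^ h n], the expansion of [alpha] begins with that of
   [alpha_n]. Hence every nonzero digit beyond the first [h n] ones contributes
   at most [alpha - alpha_n <= 2 ^ (1 - h (n+1))], and the denominator of the
   corresponding value of the sum approximation exceeds [f (n+1)]. As the graph
   of [f] is elementary, [f (n+1)] is found by a search below that bound, which
   is computed from [f n]: this is a primitive recursion. Neither the primes
   nor [h] need be computed, primitive recursive bounds on them suffice. *)

Require Import Defs.
From mathcomp Require Import all_boot all_order all_algebra.
From mathcomp Require Import all_classical all_reals all_analysis.
From mathcomp Require Import zify.

Set Implicit Arguments.
Unset Strict Implicit.
Unset Printing Implicit Defensive.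

Import Order.TTheory GRing.Theory Num.Theory.
Import numFieldNormedType.Exports.

Local Open Scope classical_set_scope.
Local Open Scope nat_scope.

(** * Closure properties of relative primitive recursion *)

Section PrimrecIn.
Variables (p : nat) (psi : natfun p).
Local Notation PR := (primrec_in psi).

Lemma primrec_in_ext n (f g : natfun n) : (forall v, f v = g v) -> PR f -> PR g.
Proof. by move=> /funext ->. Qed.

Lemma primrec_in_elementary n (f : natfun n) : elementary f -> PR f.
Proof.
elim=> {n f} [n f|m n f h g _ hh _ hg fE|n f g h j _ hg _ hh _ _ fE _].
- exact: prin_initial.
- exact: prin_comp hh hg fE.
- exact: prin_primrec hg hh fE.
Qed.

Lemma primrec_in_nth n i : i < n -> PR ((fun v => nth 0 v i) : natfun n).
Proof.
move=> lt_in; apply: (primrec_in_ext (f := fun v => tnth v (Ordinal lt_in))).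
  by move=> v; rewrite (tnth_nth 0).
exact/prin_initial/initial_proj.
Qed.

Lemma primrec_in_comp1 n (f : nat -> nat) (g : natfun n) :
  PR (natfun1 f) -> PR g -> PR ((fun v => f (g v)) : natfun n).
Proof.
move=> hf hg; apply: (prin_comp (g := fun=> g) hf) => // v.
by rewrite /natfun1 -(tnth_nth 0 _ (ord0 : 'I_1)) tnth_mktuple.
Qed.

Lemma primrec_in_comp2 n (f : nat -> nat -> nat) (g1 g2 : natfun n) :
  PR (natfun2 f) -> PR g1 -> PR g2 ->
  PR ((fun v => f (g1 v) (g2 v)) : natfun n).
Proof.
move=> hf hg1 hg2.
apply: (prin_comp (g := fun i : 'I_2 => if i == 0 :> nat then g1 else g2) hf).
  by move=> i; case: ifP.
move=> v; rewrite /natfun2.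
rewrite -(tnth_nth 0 _ (ord0 : 'I_2)) -(tnth_nth 0 _ (ord_max : 'I_2)).
by rewrite !tnth_mktuple.
Qed.

Lemma primrec_in_succ n (g : natfun n) :
  PR g -> PR ((fun v => (g v).+1) : natfun n).
Proof. exact/primrec_in_comp1/prin_initial/initial_succ. Qed.

Lemma primrec_in_const n c : PR ((fun=> c) : natfun n).
Proof.
elim: c => [|c]; last exact: primrec_in_succ.
apply: (prin_comp (m := 0) (h := fun=> 0) (g := fun=> fun=> 0)) => //.
- exact/prin_initial/initial_zero.
- by case.
Qed.

(** [F 0] enters as a constant function, so only the step has to be computed. *)
Lemma primrec_in_rec1 (F : nat -> nat) (h : nat -> nat -> nat) :
  PR (natfun2 h) -> (forall y, F y.+1 = h y (F y)) -> PR (natfun1 F).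
Proof.
move=> hh FS; apply: (prin_primrec (n := 0) (primrec_in_const 0 (F 0)) hh).
by split=> [//|y v]; rewrite /natfun1 /natfun2 /= FS.
Qed.

Lemma primrec_in_rec2 (F : nat -> nat -> nat) (g : nat -> nat)
    (h : natfun 3) :
  PR (natfun1 g) -> PR h -> (forall x, F 0 x = g x) ->
  (forall y x, F y.+1 x = h [tuple y; F y x; x]) -> PR (natfun2 F).
Proof.
move=> hg hh F0 FS; apply: (prin_primrec hg hh).
split=> [|y] v; rewrite /natfun1 /natfun2 /= ?F0 ?FS //.
by congr h; apply: val_inj; case: v => [[|x []]].
Qed.

Lemma primrec_in_swap (F : nat -> nat -> nat) :
  PR (natfun2 (fun x y => F y x)) -> PR (natfun2 F).
Proof. by move=> hF; apply: (primrec_in_comp2 hF); exact: primrec_in_nth. Qed.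

Lemma primrec_in_add : PR (natfun2 addn).
Proof.
apply: (@primrec_in_rec2 _ id (fun v => (nth 0 v 1).+1)) => //.
- exact: primrec_in_nth.
- exact/primrec_in_succ/primrec_in_nth.
Qed.

Lemma primrec_in_mul : PR (natfun2 muln).
Proof.
apply: (@primrec_in_rec2 _ (fun=> 0) (fun v => nth 0 v 2 + nth 0 v 1)) => //.
- exact: primrec_in_const.
- by apply: (primrec_in_comp2 primrec_in_add); exact: primrec_in_nth.
Qed.

Lemma primrec_in_exp : PR (natfun2 expn).
Proof.
apply: primrec_in_swap.
apply: (@primrec_in_rec2 _ (fun=> 1) (fun v => nth 0 v 2 * nth 0 v 1)).
- exact: primrec_in_const.
- by apply: (primrec_in_comp2 primrec_in_mul); exact: primrec_in_nth.
- by move=> x; rewrite expn0.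
- by move=> y x; rewrite expnS.
Qed.

Lemma primrec_in_fact : PR (natfun1 factorial).
Proof.
apply: (@primrec_in_rec1 _ (fun y z => y.+1 * z)); last exact: factS.
apply: (primrec_in_comp2 primrec_in_mul); last exact: primrec_in_nth.
exact/primrec_in_succ/primrec_in_nth.
Qed.

(** Recursion on the bound [y]: the value stays 0 until [y] reaches [f x], where the graph test adds
    [f x]. No other [y] passes the test, so the sum does not change again. *)
Lemma primrec_in_bounded_search (f : nat -> nat) :
  PR (natfun2 (fun x y => f x == y : nat)) ->
  PR (natfun2 (fun y x => if f x <= y then f x else 0)).
Proof.
move=> hr.
pose h : natfun 3 := fun v =>
  nth 0 v 1 + (nth 0 v 0).+1 * (f (nth 0 v 2) == (nth 0 v 0).+1).
have hS : PR ((fun v => (nth 0 v 0).+1) : natfun 3).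
  exact/primrec_in_succ/primrec_in_nth.
apply: (@primrec_in_rec2 _ (fun=> 0) h).
- exact: primrec_in_const.
- apply: (primrec_in_comp2 primrec_in_add); first exact: primrec_in_nth.
  apply: (primrec_in_comp2 primrec_in_mul) => //.
  by apply: (primrec_in_comp2 hr) => //; exact: primrec_in_nth.
- by move=> x; case: leqP; lia.
- move=> y x; rewrite /h /=.
  case: eqP => /= [->|ne_fx]; rewrite ?muln1 ?muln0 ?ltnn ?leqnn //.
  by rewrite addn0 leq_eqVlt; move/eqP/negPf: ne_fx => ->.
Qed.

End PrimrecIn.

(* A primitive recursive common multiple of the first primes, used as base of
   the expansion: [(base n).+1] bounds the next prime by Euclid's argument. *)
Fixpoint base (n : nat) : nat :=
  if n is n'.+1 then (base n').+1`! else 2.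

(** The recursion of [gseq] with [nth_prime] replaced by its majorant [base]. *)
Fixpoint gbound (j : nat) : nat :=
  if j is j'.+1 then base j' ^ (2 * (j' + 2) * (gbound j' + 1) ^ 3) else 1.

Section PrimrecBounds.
Variables (p : nat) (psi : natfun p).

Lemma primrec_in_base : primrec_in psi (natfun1 base).
Proof.
apply: (@primrec_in_rec1 _ _ _ (fun _ z => z.+1`!)) => //.
apply: (primrec_in_comp1 (primrec_in_fact _)).
exact/primrec_in_succ/primrec_in_nth.
Qed.

Lemma primrec_in_gbound : primrec_in psi (natfun1 gbound).
Proof.
apply: (@primrec_in_rec1 _ _ _
  (fun j z => base j ^ (2 * (j + 2) * (z + 1) ^ 3))) => //.
apply: (primrec_in_comp2 (primrec_in_exp _)).
  by apply: (primrec_in_comp1 primrec_in_base); exact: primrec_in_nth.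
apply: (primrec_in_comp2 (primrec_in_mul _)).
  apply: (primrec_in_comp2 (primrec_in_mul _)); first exact: primrec_in_const.
  apply: (primrec_in_comp2 (primrec_in_add _)); last exact: primrec_in_const.
  exact: primrec_in_nth.
apply: (primrec_in_comp2 (primrec_in_exp _)); last exact: primrec_in_const.
apply: (primrec_in_comp2 (primrec_in_add _)); last exact: primrec_in_const.
exact: primrec_in_nth.
Qed.

End PrimrecBounds.

(** * Growth of the primes and of the sequence g *)

Lemma nth_prime_prime i : prime (nth_prime i).
Proof.
by case: i => [//|i]; rewrite /nth_prime /=; case: ex_minnP => m /andP[].
Qed.

Lemma nth_prime_gt1 i : 1 < nth_prime i.
Proof. exact/prime_gt1/nth_prime_prime. Qed.

Lemma nth_prime_lt i : nth_prime i < nth_prime i.+1.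
Proof.
by rewrite {2}/nth_prime /= -/(nth_prime i); case: ex_minnP => m /andP[].
Qed.

(** Euclid's argument: with m the current prime, a prime factor of m! + 1 that is at most m would
    divide m!, hence 1. *)
Lemma nth_prime_le_fact i : nth_prime i.+1 <= (nth_prime i)`!.+1.
Proof.
set m := nth_prime i.
have m1_gt1 : 1 < m`!.+1 by rewrite ltnS fact_gt0.
rewrite /nth_prime /= -/(nth_prime i) -/m; case: ex_minnP => q _ minq.
apply: leq_trans (pdiv_leq (ltnW m1_gt1)); apply: minq.
rewrite pdiv_prime // andbT; case: ltnP => // le_pm.
have dvd_fact : pdiv m`!.+1 %| m`! by rewrite dvdn_fact // pdiv_gt0.
have := pdiv_dvd m`!.+1; rewrite -[X in _ %| X]addn1 dvdn_addr // dvdn1.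
by move/eqP => p1; have := pdiv_prime m1_gt1; rewrite p1.
Qed.

Lemma leq_fact m n : m <= n -> m`! <= n`!.
Proof.
case: m => [_|m]; first exact: fact_gt0.
by rewrite leq_eqVlt => /predU1P[->//|/ltn_fact lt_mn]; exact/ltnW/lt_mn.
Qed.

Lemma base_gt1 i : 1 < base i.
Proof.
by elim: i => [//|i IHi] /=; apply: leq_trans (fact_geq _); exact: ltnW.
Qed.

(** Bounding the factorial makes the induction close: the next prime is at most [(base i).+1], whose
    factorial is [base i.+1]. *)
Lemma nth_prime_fact_le_base i : (nth_prime i)`! <= base i.
Proof.
elim: i => [//|i IHi] /=; apply: leq_fact.
exact: leq_trans (nth_prime_le_fact i) _.
Qed.

Lemma nth_prime_le_base i : nth_prime i <= base i.
Proof. exact: leq_trans (fact_geq _) (nth_prime_fact_le_base i). Qed.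

(** For positive [n], [base n] is a factorial, and its argument is at least the [n]-th prime. *)
Lemma nth_prime_dvd_base i n : i <= n -> nth_prime i %| base n.
Proof.
move=> le_in; have le_P : nth_prime i <= nth_prime n.
  apply: (homo_leq (r := leq)) le_in => // [|j]; first exact: leq_trans.
  exact/ltnW/nth_prime_lt.
case: n le_in le_P => [|n] le_in le_P.
  by move: le_in; rewrite leqn0 => /eqP ->.
rewrite /= dvdn_fact // (ltnW (nth_prime_gt1 i)) (leq_trans le_P) //.
by rewrite (leq_trans (nth_prime_le_fact n)) // ltnS nth_prime_fact_le_base.
Qed.

Lemma gseqS j :
  gseq j.+1 = nth_prime j ^ (2 * (j + 2) * (gseq j + 1) ^ 3).
Proof. by []. Qed.

Lemma gseq_exponent_gt0 j x : 0 < 2 * (j + 2) * (x + 1) ^ 3.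
Proof. by rewrite muln_gt0 expn_gt0 addn1 addn2. Qed.

(** The constant 4 is the least value of [2 * (j + 2)]. *)
Lemma gseqS_ge j : 2 ^ (4 * (gseq j + 1) ^ 3) <= gseq j.+1.
Proof.
rewrite gseqS; apply: (@leq_trans (2 ^ (2 * (j + 2) * (gseq j + 1) ^ 3))).
  by rewrite leq_exp2l // leq_mul2r; apply/orP; right; lia.
by rewrite leq_exp2r ?nth_prime_gt1 // gseq_exponent_gt0.
Qed.

Lemma cube_lt_gseqS j : (gseq j + 1) ^ 3 < gseq j.+1.
Proof.
apply: leq_trans (gseqS_ge j); apply: leq_trans (ltn_expl _ (ltnSn 1)) _.
by rewrite leq_exp2l //; lia.
Qed.

Lemma gseq_lt j : gseq j < gseq j.+1.
Proof. apply: leq_ltn_trans (cube_lt_gseqS j); rewrite !expnS expn0; nia. Qed.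

Lemma gseq_le : {homo gseq : i j / i <= j}.
Proof.
by apply: homo_leq => [//||j]; [exact: leq_trans|exact/ltnW/gseq_lt].
Qed.

Lemma gseq_gtn j : j < gseq j.
Proof. by elim: j => [//|j IHj]; exact: leq_ltn_trans IHj (gseq_lt j). Qed.

Lemma gseq_le_gbound j : gseq j <= gbound j.
Proof.
elim: j => [//|j IHj]; rewrite gseqS /=.
apply: (@leq_trans (base j ^ (2 * (j + 2) * (gseq j + 1) ^ 3))).
  by rewrite leq_exp2r ?nth_prime_le_base // gseq_exponent_gt0.
rewrite leq_exp2l ?base_gt1 // leq_mul2l leq_exp2r // leq_add2r IHj.
by rewrite orbT.
Qed.

Lemma fact_le_exp2 n : n`! <= 2 ^ (n ^ 2).
Proof.
elim: n => [//|n IHn]; rewrite factS.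
have -> : n.+1 ^ 2 = n.+1 + (n + n ^ 2) by lia.
rewrite expnD leq_mul ?(ltnW (ltn_expl _ _)) // (leq_trans IHn) //.
by rewrite leq_exp2l // leq_addl.
Qed.

(** The induction hypothesis yields [base n <= gseq n.+1], because [gseq] gains an exponential at
    each step; the factorial then costs only a square in the exponent. *)
Lemma base_le_exp2 n : base n <= 2 ^ ((gseq n + 1) ^ 2).
Proof.
elim: n => [//|n IHn] /=; apply: leq_trans (fact_le_exp2 _) _.
rewrite leq_exp2l // leq_exp2r // addn1 ltnS.
apply: leq_trans IHn (leq_trans _ (gseqS_ge n)).
rewrite leq_exp2l // (expnS _ 2); nia.
Qed.

(** In the exponent, [base n] costs the square of [gseq j + 1] and the power one more factor
    [gseq j]; [cube_lt_gseqS] covers the product. *)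
Lemma base_exp_le n j : n <= j -> base n ^ gseq j <= 2 ^ (gseq j.+1).-1.
Proof.
move=> /gseq_le le_g.
apply: (@leq_trans (2 ^ ((gseq j + 1) ^ 2 * gseq j))).
  rewrite expnM leq_exp2r; last by rewrite (leq_ltn_trans _ (gseq_gtn j)).
  apply: leq_trans (base_le_exp2 n) _.
  by rewrite leq_exp2l // leq_exp2r // leq_add2r.
have := cube_lt_gseqS j; rewrite leq_exp2l // !expnS expn0; nia.
Qed.

Section NondecreasingHseq.
Variable f : nat -> nat.
Hypothesis f_le : forall x, f x <= f x.+1.

(** The summand [i] in [hseq] turns the weak monotonicity of [f] into a strict one. *)
Lemma hseq_lt n : hseq f n < hseq f n.+1.
Proof.
apply: leq_trans (gseq_lt _) _; apply: gseq_le.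
by have := f_le n; lia.
Qed.

Lemma base_exp_hseq_le n : base n ^ hseq f n <= 2 ^ (hseq f n.+1).-1.
Proof.
apply: leq_trans (base_exp_le (leq_addl (f n) n)) _.
rewrite leq_exp2l //; have : gseq (f n + n).+1 <= hseq f n.+1.
  by apply: gseq_le; have := f_le n; lia.
lia.
Qed.

Lemma hseq_le : {homo hseq f : i j / i <= j}.
Proof.
by apply: homo_leq => [//||j]; [exact: leq_trans|exact/ltnW/hseq_lt].
Qed.

End NondecreasingHseq.

(** * Expansions in a base *)

Section Expansion.
Variables (R : realType) (b : nat).
Hypothesis b_gt1 : 1 < b.
Local Open Scope ring_scope.

Let b_gt0 k : 0 < b%:R ^+ k :> R.
Proof. by rewrite exprn_gt0 // ltr0n ltnW. Qed.

Let bV_gt0 k : 0 < b%:R ^- k :> R.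
Proof. by rewrite invr_gt0. Qed.

Lemma natr_expV_lt i j :
  (b%:R ^- i < b%:R ^- j :> R) = (j < i)%N.
Proof. by rewrite ltf_pV2 ?posrE // ltr_eXn2l // ltr1n. Qed.

Lemma natr_expV_le i j :
  (b%:R ^- i <= b%:R ^- j :> R) = (j <= i)%N.
Proof. by rewrite lef_pV2 ?posrE // ler_eXn2l // ltr1n. Qed.

Lemma cvg_natr_expV : (b%:R ^- n : R) @[n --> \oo] --> (0 : R).
Proof.
under eq_cvg do rewrite -exprVn.
apply: cvg_expr; rewrite ger0_norm ?invr_ge0 //.
by rewrite invf_lt1 ?ltr1n ?ltr0n // ltnW.
Qed.

(** One greedy step: the least position whose unit is below [r], then the largest digit keeping the
    term strictly below [r]. Strictness leaves a positive remainder, so the digits never run out. *)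
Lemma leading_digit (r : R) : 0 < r <= 1 -> exists kD : nat * nat,
  [/\ (0 < kD.1)%N, (0 < kD.2 < b)%N, kD.2%:R * b%:R ^- kD.1 < r
    & r <= (kD.2%:R + 1) * b%:R ^- kD.1].
Proof.
move=> /andP[r_gt0 r_le1].
have exk : exists k, b%:R ^- k < r.
  exists (Num.bound r^-1); rewrite invf_plt ?posrE //.
  apply: lt_trans (archi_boundP _) _; first by rewrite invr_ge0 ltW.
  by rewrite -natrX ltr_nat ltn_expl.
case: (ex_minnP exk) => k lt_kr mink.
have k_gt0 : (0 < k)%N.
  by rewrite lt0n; apply: contraTN lt_kr => /eqP->; rewrite expr0 invr1 -leNgt.
pose x := r * b%:R ^+ k.
have x_gt1 : 1 < x by rewrite -ltr_pdivrMr // div1r.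
have x_le : x <= (b.-1).+1%:R.
  rewrite prednK ?(ltnW b_gt1) // /x -(prednK k_gt0) exprS mulrCA.
  rewrite ler_piMr // -ler_pdivlMr // div1r leNgt; apply/negP => /mink.
  by rewrite -ltnS prednK // ltnn.
have exD : exists D : nat, x <= D.+1%:R by exists b.-1.
case: (ex_minnP exD) => D xD minD.
have D_gt0 : (0 < D)%N.
  by rewrite lt0n; apply: contraTN xD => /eqP->; rewrite -ltNge.
exists (k, D); split=> //=.
- by rewrite D_gt0 -(prednK (ltnW b_gt1)) ltnS minD.
- rewrite ltr_pdivrMr // ltNge -/x; apply/negP => x_leD.
  have := minD D.-1; rewrite prednK // => /(_ x_leD).
  by rewrite leqNgt ltn_predL D_gt0.
- by rewrite natr1 ler_pdivlMr.
Qed.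

Lemma expansion_exists (a : R) : 0 < a <= 1 -> exists Dk, is_expansion a b Dk.
Proof.
move=> a01.
have /choice[next nextP] : forall r : R, exists kD : nat * nat, 0 < r <= 1 ->
    [/\ (0 < kD.1)%N, (0 < kD.2 < b)%N, kD.2%:R * b%:R ^- kD.1 < r
      & r <= (kD.2%:R + 1) * b%:R ^- kD.1].
  move=> r; have [/leading_digit[kD ?]|nr] := pselect (0 < r <= 1).
    by exists kD.
  (* An arbitrary value: by [rem01] below, the remainders never leave the interval where [next] is
     specified. *)
  by exists (0%N, 0%N).
pose rem n := iter n (fun r => r - (next r).2%:R * b%:R ^- (next r).1) a.
have rem01 n : 0 < rem n <= 1.
  elim: n => [//|n IHn] /=; have [_ _ lt_r _] := nextP _ IHn.
  rewrite subr_gt0 lt_r /=; case/andP: IHn => _; apply: le_trans.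
  by rewrite gerBl mulr_ge0 // ltW.
pose k n := (next (rem n)).1.
have remS_le n : rem n.+1 <= b%:R ^- k n.
  by have [_ _ _] := nextP _ (rem01 n); rewrite mulrDl mul1r lerBlDl.
(* The unit at the new position is below the remainder, which is at most the unit at the old
   position. *)
have k_lt n : (k n < k n.+1)%N.
  rewrite -natr_expV_lt; apply: lt_le_trans (remS_le n).
  have [_ /andP[D_gt0 _] + _] := nextP _ (rem01 n.+1); apply: le_lt_trans.
  by rewrite ler_peMl ?ler1n // ltW.
exists (fun n => (next (rem n)).2, k); split=> //=.
- by move=> i; have [] := nextP _ (rem01 i).
- by have [] := nextP _ (rem01 0).
have k_ge n : (n <= k n)%N.
  by elim: n => // n IHn; apply: leq_ltn_trans IHn (k_lt n).
have serE n : series (fun i => (next (rem i)).2%:R * b%:R ^- k i) n = a - rem n.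
  elim: n => [|n IHn]; first by rewrite /series /= big_geq // subrr.
  by rewrite seriesSr IHn /= /k opprB [RHS]addrA addrAC.
have rem_cvg : rem @ \oo --> (0 : R).
  rewrite -(cvg_shiftS rem).
  apply: (squeeze_cvgr _ (cvg_cst 0) cvg_natr_expV).
  apply: nearW => n; rewrite (ltW (andP (rem01 n.+1)).1) /=.
  by apply: le_trans (remS_le n) _; rewrite natr_expV_le.
rewrite (_ : series _ = fun n => a - rem n); last exact/funext.
rewrite -[X in _ --> X]subr0; apply: cvgB => //; exact: cvg_cst.
Qed.

Lemma expansionP (a : R) : 0 < a <= 1 -> is_expansion a b (expansion a b).
Proof. by move=> /expansion_exists; exact: xgetPex. Qed.

Section Terms.
Variables (a : R) (Dk : (nat -> nat) * (nat -> nat)).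
Hypothesis exp_a : is_expansion a b Dk.
Local Notation D := Dk.1.
Local Notation k := Dk.2.
Local Notation S := (series (fun i => (D i)%:R * b%:R ^- k i : R)).

Let D_gt0 i : (0 < D i)%N. Proof. by have [/(_ i)/andP[]] := exp_a. Qed.

Let term_gt0 i : 0 < (D i)%:R * b%:R ^- k i :> R.
Proof. by rewrite mulr_gt0 // ltr0n. Qed.

Let S_le : {homo S : m n / (m <= n)%N >-> m <= n}.
Proof.
by apply: homo_leq => [//||n]; [exact: le_trans|rewrite seriesSr lerDl ltW].
Qed.

Let S_cvg : S @ \oo --> a. Proof. by have [] := exp_a. Qed.

Lemma expansion_series_le n : S n <= a.
Proof.
rewrite -(cvg_lim (@Rhausdorff R) S_cvg); apply: nondecreasing_cvgn_le => //.
by apply/cvg_ex; exists a.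
Qed.

Lemma expansion_index_gt n : (n < k n)%N.
Proof.
have [_ k0 kS _] := exp_a.
by elim: n => // n IHn; apply: leq_ltn_trans IHn (kS n).
Qed.

(** The added power is the value of a tail with all digits [b - 1] from position [k n] on. The
    right-hand side decreases in [n] since a digit plus one is at most [b], and it dominates the
    partial sums. *)
Lemma expansion_tail_le n : a <= S n + b%:R ^- (k n).-1.
Proof.
pose u n := S n + b%:R ^- (k n).-1.
have u_le : {homo u : m n / (m <= n)%N >-> n <= m}.
  apply: (homo_leq (r := fun x y => y <= x)) => [//|y x z yx zy|i].
    exact: le_trans zy yx.
  rewrite /u seriesSr -addrA lerD2l.
  have [/(_ i)/andP[_ Db] _ /(_ i) kS _] := exp_a.
  apply: (@le_trans _ _ ((D i)%:R * b%:R ^- k i + 1 * b%:R ^- k i)).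
    by rewrite lerD2l mul1r natr_expV_le; lia.
  have k_gt0 : (0 < k i)%N := leq_ltn_trans (leq0n _) (expansion_index_gt i).
  rewrite -mulrDl natr1 -{1}(prednK k_gt0).
  rewrite exprS invfM mulrA ler_piMl // ?(ltW (bV_gt0 _)) //.
  by rewrite ler_pdivrMr ?ltr0n ?(ltnW b_gt1) // mul1r ler_nat.
rewrite -(cvg_lim (@Rhausdorff R) S_cvg); apply: limr_le.
  by apply/cvg_ex; exists a.
exists n => // m /= le_nm; apply: le_trans (u_le _ _ le_nm).
by rewrite lerDl ltW.
Qed.

Lemma series_mul_exp_nat m H : (forall i, (i < m)%N -> (k i <= H)%N) ->
  exists A : nat, S m * b%:R ^+ H = A%:R.
Proof.
elim: m => [|m IHm] kH; first by exists 0%N; rewrite /series /= big_geq // mul0r.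
have [i im|A SA] := IHm; first by apply: kH; rewrite ltnW.
exists (A + D m * b ^ (H - k m))%N.
rewrite seriesSr mulrDl SA natrD natrM natrX -mulrA; congr (_ + _ * _).
rewrite -{1}(subnKC (kH m (ltnSn m))) exprD mulKf //.
exact: lt0r_neq0.
Qed.

(* If [a] exceeds a multiple of [b^-H] by a small [e], the digits of weight at
   least [b^-H] are those of that multiple, so that all the later ones add up
   to [e]. *)
Lemma expansion_term_le H A (e : R) N :
  a = A%:R * b%:R ^- H + e -> 0 < e <= b%:R ^- H -> (H <= N)%N ->
  (D N)%:R * b%:R ^- k N <= e.
Proof.
move=> aE /andP[e_gt0 e_le] HN.
have exm : exists m, (H < k m)%N by exists H; exact: expansion_index_gt.
(* [m] counts the nonzero digits at positions up to [H]. *)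
case: (ex_minnP exm) => m Hm minm.
have mH : (m <= H)%N by apply/minm/expansion_index_gt.
have [|A' SA'] := @series_mul_exp_nat m H.
  by move=> i im; rewrite leqNgt; apply: contraTN im => /minm; rewrite -leqNgt.
have aSm : S m < a.
  apply: lt_le_trans (expansion_series_le m.+1).
  by rewrite seriesSr ltrDl.
have aSm' : a <= S m + b%:R ^- H.
  apply: le_trans (expansion_tail_le m) _; rewrite lerD2l natr_expV_le.
  by rewrite -ltnS (leq_trans Hm) // leqSpred.
have SmE : S m = A'%:R * b%:R ^- H.
  by rewrite -SA' mulfK // lt0r_neq0.
(* Both are multiples of the unit at position [H] that lie below [a] by a positive amount of at most
   one unit; there is only one such multiple. *)
have AA' : A = A'.
  have ltP i j : i%:R * b%:R ^- H < j%:R * b%:R ^- H + b%:R ^- H :> R ->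
      (i <= j)%N.
    by rewrite -[X in _ + X]mul1r -mulrDl ltr_pM2r // natr1 ltr_nat ltnS.
  apply/eqP; rewrite eqn_leq; apply/andP; split; apply: ltP; rewrite -SmE.
    by apply: lt_le_trans aSm'; rewrite aE ltrDl.
  by apply: (lt_le_trans aSm); rewrite aE lerD2l.
have -> : e = a - S m by rewrite aE SmE AA' addrC addKr.
rewrite lerBrDl; apply: le_trans (expansion_series_le N.+1).
by rewrite seriesSr lerD2r; apply: S_le; exact: leq_trans mH HN.
Qed.

End Terms.
End Expansion.

(** * The expansion of alpha *)

Section Alpha.
Variables (R : realType) (f : nat -> nat).
Hypothesis f_le : forall x, f x <= f x.+1.
Local Open Scope ring_scope.
Local Notation P := nth_prime.
Local Notation h := (hseq f).
Local Notation alpha_ := (alpha_seq R f).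

Lemma alpha_seqS n : alpha_ n.+1 = alpha_ n + (P n.+1)%:R ^- h n.+1.
Proof. by rewrite /alpha_seq big_ord_recr. Qed.

Lemma nth_prime_expV_gt0 i m : 0 < (P i)%:R ^- m :> R.
Proof. by rewrite invr_gt0 exprn_gt0 // ltr0n ltnW // nth_prime_gt1. Qed.

Lemma nth_prime_expV_le i m : (P i)%:R ^- m <= 2%:R ^- m :> R.
Proof.
rewrite lef_pV2 ?posrE ?exprn_gt0 ?ltr0n ?(ltnW (nth_prime_gt1 i)) //.
by rewrite lerXn2r ?nnegrE ?ler0n // ler_nat nth_prime_gt1.
Qed.

Lemma hseq_gt0 n : (0 < h n)%N.
Proof. exact: leq_ltn_trans (leq0n _) (gseq_gtn _). Qed.

Lemma exp2V_pred m : (0 < m)%N -> 2%:R ^- m.-1 = 2%:R ^- m + 2%:R ^- m :> R.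
Proof.
move=> m_gt0; rewrite -[LHS]mul1r [X in X * _]splitr div1r mulrDl.
by rewrite -invfM -exprS prednK.
Qed.

Let u n : R := alpha_ n + 2%:R ^- (h n.+1).-1.

(** By [exp2V_pred] the error term splits into two halves: one covers the next summand, the other
    the next error term. *)
Let u_le : {homo u : m n / (m <= n)%N >-> n <= m}.
Proof.
apply: (homo_leq (r := fun x y => y <= x)) => [//|y x z yx zy|i].
  exact: le_trans zy yx.
rewrite /u alpha_seqS -addrA lerD2l (exp2V_pred (hseq_gt0 i.+1)).
rewrite lerD ?nth_prime_expV_le // natr_expV_le //.
by have := hseq_lt f_le i.+1; lia.
Qed.

Let alpha_seq_le : {homo alpha_ : m n / (m <= n)%N >-> m <= n}.
Proof.
apply: homo_leq => [//||n]; first exact: le_trans.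
by rewrite alpha_seqS lerDl ltW // nth_prime_expV_gt0.
Qed.

Let alpha_seq_le_u m n : alpha_ m <= u n.
Proof.
apply: (@le_trans _ _ (alpha_ (maxn m n))); first exact/alpha_seq_le/leq_maxl.
apply: le_trans (u_le (leq_maxr m n)).
by rewrite lerDl invr_ge0 exprn_ge0.
Qed.

Lemma alpha_is_cvg : cvgn alpha_.
Proof.
apply: nondecreasing_is_cvgn => //.
by exists (u 0) => _ [n _ <-]; exact: alpha_seq_le_u.
Qed.

Lemma alpha_gt n : alpha_ n < alpha R f.
Proof.
apply: lt_le_trans (nondecreasing_cvgn_le alpha_seq_le alpha_is_cvg n.+1).
by rewrite alpha_seqS ltrDl nth_prime_expV_gt0.
Qed.

Lemma alpha_le n : alpha R f <= alpha_ n + 2%:R ^- (h n.+1).-1.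
Proof.
apply: limr_le; first exact: alpha_is_cvg.
by apply: nearW => m; exact: alpha_seq_le_u.
Qed.

Lemma alpha01 : 0 < alpha R f <= 1.
Proof.
apply/andP; split.
  apply: le_lt_trans (alpha_gt 0).
  by rewrite /alpha_seq big_ord1 ltW // nth_prime_expV_gt0.
apply: le_trans (alpha_le 0) _.
have half n : (0 < n)%N -> 2%:R ^- n <= 2^-1 :> R.
  by move=> n0; rewrite -[X in _ <= X^-1]expr1 (@natr_expV_le R 2).
rewrite [leRHS]splitr div1r; apply: lerD.
  rewrite /alpha_seq big_ord1.
  by apply: le_trans (nth_prime_expV_le _ _) _; exact/half/hseq_gt0.
by apply: half; have := hseq_lt f_le 0; have := hseq_gt0 0; lia.
Qed.

(** Each prime involved divides [base n] and each exponent is at most [hseq f n], so every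
    denominator divides the common one. *)
Lemma alpha_seq_mul_nat n :
  exists A : nat, alpha_ n = A%:R * (base n)%:R ^- h n.
Proof.
suff [A AE] : exists A : nat, alpha_ n * (base n)%:R ^+ h n = A%:R.
  exists A; rewrite -AE mulfK // expf_neq0 // pnatr_eq0.
  by have := base_gt1 n; lia.
rewrite /alpha_seq mulr_suml.
suff fAE (i : 'I_n.+1) : exists A : nat,
    (P i)%:R ^- h i * (base n)%:R ^+ h n = A%:R :> R.
  have [A AE] := choice fAE; exists (\sum_i A i)%N.
  by rewrite natr_sum; apply: eq_bigr => i _.
have [le_in] : (i <= n)%N by rewrite -ltnS.
have /dvdnP[q qE] : (P i ^ h i %| base n ^ h n)%N.
  apply: dvdn_trans (dvdn_exp2l _ (hseq_le f_le le_in)).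
  exact/dvdn_exp2r/nth_prime_dvd_base.
exists q; rewrite -!natrX qE natrM mulrC mulfK // pnatr_eq0 -lt0n.
by rewrite expn_gt0 (ltnW (nth_prime_gt1 i)).
Qed.

(** An instance of [expansion_term_le] with [H := hseq f n] and the error of [alpha_seq] as [e];
    [base_exp_hseq_le] bounds this error by one unit. The argument [N.+1] of [ghat] reads the digit
    of index [N], since digits are indexed from 0. *)
Lemma ghat_alpha_le n N : (h n <= N)%N ->
  0 < ghat (alpha R f) (base n) N.+1 <= 2%:R ^- (h n.+1).-1.
Proof.
move=> le_hN; have exp_a := expansionP (base_gt1 n) alpha01.
rewrite /ghat ltnNge base_gt1 /=.
set D := _.1 N; set k := _.2 N.
have D_gt0 : (0 < D)%N by have [/(_ N)/andP[]] := exp_a.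
have base_gt0 : (0 < base n)%N by rewrite ltnW ?base_gt1.
rewrite mulr_gt0 ?ltr0n ?invr_gt0 ?exprn_gt0 ?ltr0n //=.
have [A AE] := alpha_seq_mul_nat n.
have e01 : 0 < alpha R f - alpha_ n <= (base n)%:R ^- h n.
  rewrite subr_gt0 alpha_gt lerBlDl /=; apply: le_trans (alpha_le n) _.
  rewrite lerD2l lef_pV2 ?posrE ?exprn_gt0 ?ltr0n // -!natrX ler_nat.
  exact: base_exp_hseq_le.
have := @expansion_term_le R _ (base_gt1 n) _ _ exp_a (h n) A _ N _ e01 le_hN.
rewrite -AE addrC subrK -/D -/k => /(_ erefl) le_term.
(* The bound holds in [R], while [ghat] takes values in [rat]; clearing denominators turns both
   statements into the same inequality of natural numbers. *)
have {le_term} : D%:R * (base n)%:R ^- k <= 2%:R ^- (h n.+1).-1 :> R.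
  by apply: le_trans le_term _; rewrite lerBlDl alpha_le.
rewrite !ler_pdivrMr ?exprn_gt0 ?ltr0n // ![_^-1 * _]mulrC.
by rewrite !ler_pdivlMr ?exprn_gt0 // -!natrX -!natrM !ler_nat.
Qed.

End Alpha.

(** * Small values have large codes; the recursion for f *)

(** The numerator is at least 1, so the denominator is at least [m], and a pair code is at least its
    second component. *)
Lemma leq_rat_code (q : rat) (m : nat) :
  (0 < q <= m%:R^-1)%R -> m <= rat_code q.
Proof.
move=> /andP[q_gt0 q_le]; case: m q_le => [//|m] q_le.
suff le_den : m.+1 <= absz (denq q).
  by rewrite (leq_trans le_den) // /rat_code /pair_code; nia.
have num_gt0 : (1 <= numq q)%R by rewrite -gtz0_ge1 numq_gt0.
have den_gt0 : (0 < (denq q)%:~R :> rat)%R by rewrite ltr0z denq_gt0.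
rewrite -lez_nat absz_denq -(ler_int rat) -lef_pV2 ?posrE //.
  apply: le_trans q_le; rewrite -[leRHS]divq_num_den -[leLHS]div1r.
  by rewrite ler_pM2r ?invr_gt0 // -[X in (X <= _)%R]/(1%:~R)%R ler_int.
Qed.

(** The code is at least 2 to the power [(hseq f n.+1).-1], and already this exponent is at least
    [f n.+1] by [gseq_gtn]. *)
Lemma leq_ghat_alpha_code (R : realType) (f : nat -> nat) n N :
  (forall x, f x <= f x.+1) -> hseq f n <= N ->
  f n.+1 <= rat_code (ghat (alpha R f) (base n) N.+1).
Proof.
move=> f_le le_hN; have := ghat_alpha_le R f_le le_hN.
rewrite -natrX => /leq_rat_code; apply: leq_trans.
apply: leq_trans (ltnW (ltn_expl _ (ltnSn 1))).
by have := gseq_gtn (f n.+1 + n.+1); rewrite -/(hseq f n.+1); lia.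
Qed.

Theorem theorem2 (R : realType) (f : nat -> nat) (hf : honest f) :
  primrec_in (ghat_coded (alpha R f)) (natfun1 f).
Proof.
have [f_le _ /(primrec_in_elementary (ghat_coded (alpha R f))) f_rel] := hf.
have search := primrec_in_bounded_search f_rel.
set psi := ghat_coded _ in search *.
(* [y] stands for the previous value [f n]; then [gbound (y + n)] bounds [hseq f n], so that the
   digit read lies beyond those of the partial sum. *)
pose bnd n y := rat_code (ghat (alpha R f) (base n) (gbound (y + n)).+1).
apply: (@primrec_in_rec1 _ _ _
  (fun n y => if f n.+1 <= bnd n y then f n.+1 else 0)).
  apply: (primrec_in_comp2 search); last exact/primrec_in_succ/primrec_in_nth.
  apply: (primrec_in_comp2 (prin_oracle psi)).
    by apply: (primrec_in_comp1 (primrec_in_base _)); exact: primrec_in_nth.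
  apply/primrec_in_succ/(primrec_in_comp1 (primrec_in_gbound _)).
  by apply: (primrec_in_comp2 (primrec_in_add _)); exact: primrec_in_nth.
(* At [y = f n] the bound is large enough, so the search never returns its default 0. *)
move=> n; rewrite leq_ghat_alpha_code //; exact: gseq_le_gbound.
Qed.
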